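(* Let $A$ be a complex unital Banach algebra with unit $1$, $\|1\|=1$, and suppose that, as a Banach space, $A$ is the dual of a Banach space $A_{\sharp}$. Then the set $D_A$ of all dissipative elements of $A$ is a weak* closed subset of $A$ (that is, closed in the topology $\sigma(A,A_\sharp)$). Moreover, the set $S_n(A)$ of normal (weak* continuous) states is weak* dense in the set $S(A)$ of all states on $A$ (that is, dense with respect to the topology $\sigma(A^{\sharp},A)$).
   Context: $A^{\sharp}$ denotes the Banach space dual of $A$. When $A$ is the dual of the Banach space $A_{\sharp}$ (with the norm of $A$ being the dual norm), $A_{\sharp}$ is regarded as a subspace of $A^{\sharp}$ via the canonical embedding, namely as the set of all weak* (i.e. $\sigma(A,A_\sharp)$-) continuous linear functionals on $A$. No compatibility between the multiplication of $A$ and its weak* topology is assumed. The set of states is $S(A)=\{\rho\in A^{\sharp}: \|\rho\|\leq 1,\ \rho(1)=1\}$, and the set of normal states is $S_n(A)=S(A)\cap A_{\sharp}$. The numerical range of $a\in A$ is $W(a)=\{\rho(a):\rho\in S(A)\}$. An element $a\in A$ is dissipative if $W(a)\subseteq\{z\in\mathbb{C}:\operatorname{Re} z\leq 0\}$, and $D_A$ is the set of all dissipative elements of $A$. *)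

(* Defs.v *)
From HB Require Import structures.
From mathcomp Require Import all_boot all_order all_algebra.
From mathcomp Require Import all_classical all_reals.
From mathcomp Require Import topology normedtype.
From mathcomp Require Import complex.

Set Implicit Arguments.
Unset Strict Implicit.
Unset Printing Implicit Defensive.

Import Order.TTheory GRing.Theory Num.Theory.

Local Open Scope classical_set_scope.
Local Open Scope ring_scope.
Local Open Scope complex_scope.

(* The product is a field of the mixin, and not inherited from GRing.Algebra,
   because the library has no join of its normed and ring structures; the
   GRing.Algebra structure is recovered below. *)
HB.mixin Record CompleteNormedModule_isBanachAlgebra
    (K : numFieldType) A & CompleteNormedModule K A := {
  banach_one : A ;
  banach_mul : A -> A -> A ;
  banach_mulA : associative banach_mul ;
  banach_mul1l : left_id banach_one banach_mul ;
  banach_mul1r : right_id banach_one banach_mul ;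
  banach_mulDl : left_distributive banach_mul +%R ;
  banach_mulDr : right_distributive banach_mul +%R ;
  banach_scaleAl : forall (k : K) (x y : A),
    k *: banach_mul x y = banach_mul (k *: x) y ;
  banach_scaleAr : forall (k : K) (x y : A),
    k *: banach_mul x y = banach_mul x (k *: y) ;
  banach_norm_mul : forall x y : A, `|banach_mul x y| <= `|x| * `|y| ;
  banach_norm_one : `|banach_one| = 1
}.

#[short(type="banachAlgType")]
HB.structure Definition BanachAlgebra (K : numFieldType) :=
  {A of CompleteNormedModule K A & CompleteNormedModule_isBanachAlgebra K A}.

Section BanachAlgebraRing.
Context (K : numFieldType) (A : banachAlgType K).

Lemma banach_one_neq0 : (banach_one : A) != 0.
Proof. by rewrite -normr_eq0 banach_norm_one oner_eq0. Qed.

#[non_forgetful_inheritance]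
HB.instance Definition _ := GRing.Zmodule_isNzRing.Build A
  (@banach_mulA K A) (@banach_mul1l K A) (@banach_mul1r K A)
  (@banach_mulDl K A) (@banach_mulDr K A) banach_one_neq0.

#[non_forgetful_inheritance]
HB.instance Definition _ :=
  GRing.Lmodule_isLalgebra.Build K A (@banach_scaleAl K A).

#[non_forgetful_inheritance]
HB.instance Definition _ :=
  GRing.Lalgebra_isAlgebra.Build K A (@banach_scaleAr K A).

End BanachAlgebraRing.

(* The scalars are taken in R[i]^o because R[i] itself carries no topology in
   the library. The topology sigma(dual E, E) is the one that dual E inherits
   from {ptws E -> R[i]^o}. *)
Definition dual (R : realType) (E : normedModType R[i]) : set (E -> R[i]^o) :=
  [set f : E -> R[i]^o | linear f /\ continuous f].
Arguments dual {R} E.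

(* The norm of a normed space over R[i] takes its values in R[i] (in the
   nonnegative reals); normc is the modulus of a complex number as an element
   of R. *)
Definition dual_norm (R : realType) (E : normedModType R[i])
    (f : E -> R[i]^o) : R :=
  sup [set Normc.normc (f x) | x in [set x : E | `|x| <= 1]].

(* J identifies A, as a normed space, with the dual of E. *)
Definition is_dual_of (R : realType) (A E : normedModType R[i])
    (J : A -> E -> R[i]^o) : Prop :=
  [/\ linear J, set_bij setT (dual E) J &
      forall a : A, `|a| = (dual_norm (J a))%:C].

(* sigma(A, E), when A is identified with the dual of E by J. *)
Definition weak_star (R : realType) (A E : normedModType R[i])
    (J : A -> E -> R[i]^o) : Type :=
  initial_topology (J : A -> {ptws E -> R[i]^o}).

HB.instance Definition _ (R : realType) (A E : normedModType R[i])
    (J : A -> E -> R[i]^o) :=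
  Topological.copy (weak_star J)
    (initial_topology (J : A -> {ptws E -> R[i]^o})).

(* The image of E in the dual of A. *)
Definition predual (R : realType) (A E : normedModType R[i])
    (J : A -> E -> R[i]^o) : set (A -> R[i]^o) :=
  range (fun (e : E) (a : A) => J a e).

Definition states (R : realType) (A : banachAlgType R[i]) : set (A -> R[i]^o) :=
  [set rho | [/\ dual A rho, dual_norm rho <= 1 & rho 1 = 1]].
Arguments states {R} A.

Definition normal_states (R : realType) (A : banachAlgType R[i])
    (E : normedModType R[i]) (J : A -> E -> R[i]^o) : set (A -> R[i]^o) :=
  states A `&` predual J.

Definition numerical_range (R : realType) (A : banachAlgType R[i]) (a : A) :
    set R[i] :=
  [set rho a | rho in states A].

Definition dissipative (R : realType) (A : banachAlgType R[i]) : set A :=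
  [set a | numerical_range a `<=` [set z | complex.Re z <= 0]].
Arguments dissipative {R} A.

(* Main.v *)
Require Import Defs.
From HB Require Import structures.
From mathcomp Require Import all_boot all_order all_algebra.
From mathcomp Require Import all_classical all_reals.
From mathcomp Require Import topology normedtype.
From mathcomp Require Import complex ring lra.

(** The point is that there are enough normal states: if [Re (rho a) > 0] for some
    state [rho], then [Re (phi a) > 0] for some normal state [phi]
    ([state_Re_gt0]).  Consequently [a] is dissipative if and only if
    [Re (phi a) <= 0] for all normal states [phi] ([dissipativeP]), so the
    dissipative elements form an intersection of weak* closed half-spaces.  Density
    follows too: if the values of [rho] at finitely many elements of [A] could not
    be approximated by those of normal states, separation in a finite-dimensional
    space would give an element whose real part is positive at [rho] and nonpositive
    at every normal state.

    To find [phi], take a vector [e] of the unit ball of the predual that nearly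
    attains the norm of [1 + t a] for a small [t > 0].  It is almost a state, in the
    sense that [Re (e 1) >= 1 - h^2] for a small [h], and [Re (e a)] is bounded below
    by a positive constant.  It remains to correct [e] to an exact normal state at
    distance of order [h] ([near_state_normal_state]).  This replaces the
    Krein-Smulian theorem, and it is done by iteration: within [7 h] of an
    [h^2]-near state there are [d]-near states for every [d > 0]
    ([near_state_approx]), and the predual is complete.

    A step of the iteration is a separation argument in the predual, so that it
    comes down to an estimate for [a] in the unit ball of [A] and [c] in [[-1, 1]]
    ([Re_J_near_state_le]): if [Re (e a) <= c] for all [d]-near states [e], then [Re (e a) <= c + 6 h] for all
    [h^2]-near states, uniformly in [d].  The hypothesis says that [b = a - c]
    satisfies [nrm (1 + s b) <= 1] for some small [s > 0].  The algebra structure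
    makes this quantitative ([nrm_one_addZ_le]): the resolvent of [b] is contractive,
    so [nrm (1 + t b) <= nrm ((1 - t b) (1 + t b)) <= 1 + t^2 * nrm b ^ 2] for all
    [t >= 0].

    Separation rests on the Hahn-Banach theorem, obtained from minimal sublinear
    functionals. *)

Set Implicit Arguments.
Unset Strict Implicit.
Unset Printing Implicit Defensive.

Import Order.TTheory GRing.Theory Num.Theory.
Import numFieldNormedType.Exports.

Local Open Scope classical_set_scope.
Local Open Scope ring_scope.
Local Open Scope complex_scope.

Local Notation Re := complex.Re.
Local Notation normc := Normc.normc.

(** * Sublinear functionals and separation *)

Section HahnBanach.
Context (R : realType) (V : lmodType R).
Implicit Types (p q : V -> R) (x y : V) (D C : set V).

Definition sublinear p :=
  (forall x y, p (x + y) <= p x + p y) /\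
  (forall (t : R) x, 0 <= t -> p (t *: x) = t * p x).

Definition convex C := forall x y (s t : R), 0 <= s -> 0 <= t -> s + t = 1 ->
  C x -> C y -> C (s *: x + t *: y).

Lemma sublinear0 p : sublinear p -> p 0 = 0.
Proof. by case=> _ h; rewrite -(scale0r (0 : V)) h ?mul0r. Qed.

Lemma sublinear_geN p x : sublinear p -> - p (- x) <= p x.
Proof.
move=> sp; have := sp.1 x (- x); rewrite subrr sublinear0//; lra.
Qed.

(** Applying the one-sided bound to both [t] and [t^-1] gives homogeneity, so
    only the easy half of it has to be checked for infima. *)
Lemma le_sublinear p : (forall x y, p (x + y) <= p x + p y) -> p 0 = 0 ->
  (forall (t : R) x, 0 < t -> p (t *: x) <= t * p x) -> sublinear p.
Proof.
move=> pD p0 pZ; split=> // t x; rewrite le_eqVlt => /predU1P[<-|t0].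
  by rewrite scale0r mul0r.
apply/eqP; rewrite eq_le pZ//=.
have := pZ t^-1 (t *: x); rewrite invr_gt0 scalerA mulVf ?gt_eqF// scale1r.
by move=> /(_ t0); rewrite ler_pdivlMl.
Qed.

(** The tilted functional is [q x = inf_(t >= 0, y in D) p (x - t y) - t d].  It
    is bounded below by [- p (- x)] because [t d <= p (- t y)], and convexity of
    [D] makes it subadditive.  The lemma serves twice: with [D] a point it shows
    that minimal sublinear functionals are odd, and with [D] a translated convex
    set it reduces separation to the dominated extension theorem. *)
Lemma sublinear_tilt p D (d : R) : sublinear p -> D !=set0 -> convex D ->
    (forall y, D y -> d <= p (- y)) ->
  exists q, [/\ sublinear q, forall x, q x <= p x & forall y, D y -> q y <= - d].
Proof.
move=> sp [y0 Dy0] cD dp.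
pose S x := [set r | exists t y, [/\ 0 <= t, D y & r = p (x - t *: y) - t * d]].
have lbS x : lbound (S x) (- p (- x)).
  move=> _ [t [y [t0 Dy ->]]].
  have := sp.1 (x - t *: y) (- x); rewrite addrAC subrr add0r -scalerN sp.2//.
  have := ler_wpM2l t0 (dp _ Dy); lra.
have S0 x : S x !=set0 by exists (p (x - 0 *: y0) - 0 * d), 0, y0.
have geS x t y : 0 <= t -> D y -> inf (S x) <= p (x - t *: y) - t * d.
  by move=> t0 Dy; apply: ge_inf; [exists (- p (- x)); exact: lbS|exists t, y].
have lep x : inf (S x) <= p x.
  by have := geS x 0 y0 (lexx _) Dy0; rewrite scale0r mul0r !subr0.
exists (fun x => inf (S x)); split=> //; last first.
  move=> y Dy; have := geS y 1 y ler01 Dy.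
  by rewrite scale1r subrr sublinear0// mul1r sub0r.
apply: le_sublinear => [x y||t x t0].
- rewrite -lerBlDr; apply: lb_le_inf => // _ [s [u [s0 Du ->]]].
  rewrite lerBlDl -lerBlDr; apply: lb_le_inf => // _ [t [v [t0 Dv ->]]].
  rewrite lerBlDr.
  have [st0|st0] := eqVneq (s + t) 0.
    have [-> ->] : s = 0 /\ t = 0 by lra.
    rewrite !scale0r !mul0r !subr0; apply: le_trans (lep _) _.
    by rewrite addrC; exact: sp.1.
  have st : 0 < s + t by rewrite lt_def st0 addr_ge0.
  have Dw : D ((s / (s + t)) *: u + (t / (s + t)) *: v).
    apply: cD => //; rewrite ?divr_ge0 ?addr_ge0//.
    by rewrite -mulrDl divff.
  apply: le_trans (geS _ _ _ (ltW st) Dw) _.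
  rewrite scalerDr !scalerA !mulrA ![(s + t) * _]mulrC !mulfK//.
  have := sp.1 (x - s *: u) (y - t *: v).
  by rewrite addrACA -opprD; lra.
- apply/eqP; rewrite eq_le -{1}(sublinear0 sp) lep/=.
  by apply: lb_le_inf => // r /lbS; rewrite oppr0 (sublinear0 sp) oppr0.
- rewrite -ler_pdivrMl//; apply: lb_le_inf => // _ [s [y [s0 Dy ->]]].
  rewrite ler_pdivrMl//; apply: le_trans (geS _ (t * s) _ _ Dy) _.
    by rewrite mulr_ge0// ltW.
  by rewrite -scalerA -scalerBr sp.2 ?(ltW t0)// mulrBr mulrA.
Qed.

(** Tilting [q] by the singleton of [- x] with the value [q x] gives a smaller
    sublinear functional with value at most [- q x] at [- x]; minimality makes it
    equal to [q], so [q] is odd, and an odd sublinear functional is linear. *)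
Lemma minimal_sublinear_scalar q : sublinear q ->
  (forall q', sublinear q' -> (forall x, q' x <= q x) -> q' = q) -> scalar q.
Proof.
move=> sq qmin.
have qN x : q (- x) = - q x.
  have [|||q' [sq' q'q q'x]] := @sublinear_tilt q [set - x] (q x) sq.
  - by exists (- x).
  - by move=> _ _ s t _ _ st -> ->; rewrite -scalerDl st scale1r.
  - by move=> _ ->; rewrite opprK.
  have := q'x _ erefl; rewrite (qmin q')// => h.
  by have := sublinear_geN x sq; lra.
have qD x y : q (x + y) = q x + q y.
  have := sq.1 x y; have := sq.1 (x + y) (- y); rewrite addrK qN; lra.
move=> t x y; rewrite qD; congr (_ + _).
have [t0|t0] := leP 0 t; first exact: sq.2.
by rewrite -[t]opprK scaleNr qN sq.2 ?mulNr// oppr_ge0 ltW.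
Qed.

(** Zorn's lemma: the pointwise infimum of a chain of sublinear functionals below
    [p] is finite, since each of them is bounded below by [- p (- x)]. *)
Lemma minimal_sublinear p : sublinear p -> exists q,
  [/\ sublinear q, forall x, q x <= p x &
      forall q', sublinear q' -> (forall x, q' x <= q x) -> q' = q].
Proof.
move=> sp.
pose T := {q : V -> R | sublinear q /\ forall x, q x <= p x}.
pose le_T (q1 q2 : T) := `[< forall x, sval q2 x <= sval q1 x >].
have [|r s t /asboolP rs /asboolP st||F totF|[q [sq qp]] qmin] := @Zorn T le_T.
- by move=> t; exact/asboolP.
- by apply/asboolP => x; exact: le_trans (st x) (rs x).
- move=> [q1 h1] [q2 h2] /asboolP /= q21 /asboolP /= q12.
  by apply: eq_exist; apply/funext => x; apply/eqP; rewrite eq_le q12 q21.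
- have [[q0 Fq0]|F0] := pselect (F !=set0); last first.
    by exists (exist _ p (conj sp (fun=> lexx _))) => s Fs; case: F0; exists s.
  pose S x := [set sval q x | q in F].
  have S0 x : S x !=set0 by exists (sval q0 x), q0.
  have lbS x : lbound (S x) (- p (- x)).
    move=> _ [q Fq <-]; have [sq qp] := svalP q.
    by apply: le_trans (sublinear_geN x sq); rewrite lerN2.
  have geS (q : T) x : F q -> inf (S x) <= sval q x.
    by move=> Fq; apply: ge_inf; [exists (- p (- x)); exact: lbS|exists q].
  have lep x : inf (S x) <= p x.
    by apply: le_trans (geS _ _ Fq0) _; exact: (svalP q0).2.
  have sS : sublinear (fun x => inf (S x)).
    apply: le_sublinear => [x y||t x t0].
    + rewrite -lerBlDr; apply: lb_le_inf => // _ [q1 Fq1 <-].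
      rewrite lerBlDl -lerBlDr; apply: lb_le_inf => // _ [q2 Fq2 <-].
      rewrite lerBlDr.
      have [q [Fq le1 le2]] : exists q : T, [/\ F q, sval q x <= sval q1 x &
                                              sval q y <= sval q2 y].
        by case: (totF _ _ Fq1 Fq2) => /asboolP le12; [exists q2|exists q1].
      apply: le_trans (geS q _ Fq) _.
      have [[qD _] _] := svalP q; have := qD x y; lra.
    + apply/eqP; rewrite eq_le -{1}(sublinear0 sp) lep/=.
      by apply: lb_le_inf => // r /lbS; rewrite oppr0 (sublinear0 sp) oppr0.
    + rewrite -ler_pdivrMl//; apply: lb_le_inf => // _ [q Fq <-].
      rewrite ler_pdivrMl//; apply: le_trans (geS q _ Fq) _.
      by have [[_ qZ] _] := svalP q; rewrite qZ ?(ltW t0).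
  exists (exist _ (fun x => inf (S x)) (conj sS lep)) => q Fq.
  by apply/asboolP => x /=; exact: geS.
exists q; split=> // q' sq' q'q.
have q'p x : q' x <= p x by exact: le_trans (q'q x) (qp x).
have /qmin : le_T (exist _ q (conj sq qp)) (exist _ q' (conj sq' q'p)).
  exact/asboolP.
by case.
Qed.

Lemma hahn_banach p : sublinear p ->
  exists2 f : V -> R, scalar f & forall x, f x <= p x.
Proof.
move=> /minimal_sublinear[q [sq qp qmin]].
by exists q => //; exact: minimal_sublinear_scalar.
Qed.

(** Tilting [p] by [C - x] yields a sublinear functional that is at most [- d] on
    [C - x]; every linear functional below it separates. *)
Lemma hahn_banach_separation p C x (d : R) : sublinear p -> C !=set0 ->
    convex C -> (forall c, C c -> d <= p (x - c)) ->
  exists f : V -> R, [/\ scalar f, forall y, f y <= p y &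
                         forall c, C c -> f c + d <= f x].
Proof.
move=> sp [c0 Cc0] cC dC.
have [|||q [sq qp qd]] := @sublinear_tilt p [set c - x | c in C] d sp.
- by exists (c0 - x), c0.
- move=> _ _ s t s0 t0 st [c Cc <-] [c' Cc' <-].
  exists (s *: c + t *: c'); first exact: cC.
  by rewrite !scalerBr addrACA -opprD -scalerDl st scale1r.
- by move=> _ [c Cc <-]; rewrite opprB; exact: dC.
have [f sf fq] := hahn_banach sq.
exists f; split=> // [y|c Cc]; first exact: le_trans (fq _) (qp _).
have := le_trans (fq _) (qd _ (ex_intro2 _ _ c Cc erefl)).
have -> : f (c - x) = f c - f x by rewrite -scaleN1r addrC sf mulN1r addrC.
lra.
Qed.

End HahnBanach.

Section LinearAt.
Context (K : pzRingType) (V W : lmodType K) (f : V -> W).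
Hypothesis lf : linear f.

Lemma linear_atD x y : f (x + y) = f x + f y.
Proof. by have := lf 1 x y; rewrite !scale1r. Qed.

Lemma linear_at0 : f 0 = 0.
Proof. by apply: (addrI (f 0)); rewrite -linear_atD !addr0. Qed.

Lemma linear_atZ k x : f (k *: x) = k *: f x.
Proof. by have := lf k x 0; rewrite linear_at0 !addr0. Qed.

End LinearAt.

(** * Complex normed spaces and their duals *)

Section ComplexModulus.
Context (R : realType).
Implicit Types (z w : R[i]) (t : R).

Lemma ReD z w : Re (z + w) = Re z + Re w.
Proof. by case: z w => [? ?] []. Qed.

Lemma ReB z w : Re (z - w) = Re z - Re w.
Proof. by case: z w => [? ?] []. Qed.

Lemma Re_realM t z : Re (t%:C * z) = t * Re z.
Proof. by case: z => a b /=; rewrite mul0r subr0. Qed.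

Lemma normc_ge0 z : 0 <= normc z.
Proof. by case: z => a b; exact: sqrtr_ge0. Qed.

Lemma normc_real t : 0 <= t -> normc t%:C = t.
Proof. by move=> t0; rewrite /= expr0n/= addr0 sqrtr_sqr ger0_norm. Qed.

Lemma Re_le_normc z : Re z <= normc z.
Proof.
by have := normc_ge_Re z; rewrite lecR; apply: le_trans; exact: ler_norm.
Qed.

(** Multiply by the conjugate phase of [z]. *)
Lemma normc_le_Re z (M : R) : (forall u, normc u <= 1 -> Re (u * z) <= M) ->
  normc z <= M.
Proof.
move=> h; have [z0|z0] := eqVneq (normc z) 0.
  by have := h 0; rewrite mul0r z0 Normc.normc0 => ->.
have zz : z^* * z = (normc z ^+ 2)%:C.
  by rewrite mulrC -sqr_normc -rmorphXn.
have := h ((normc z)^-1%:C * z^*).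
rewrite Normc.normcM normc_real ?invr_ge0 ?normc_ge0//.
have -> : normc z^* = normc z by apply: complexI; exact: (normcJ z).
rewrite mulVf// lexx => /(_ isT).
by rewrite -mulrA zz Re_realM/= expr2 mulKf.
Qed.

Lemma eq1_normc_Re z : normc z <= 1 -> 1 <= Re z -> z = 1.
Proof.
case: z => a b /= ab a1.
have : a ^+ 2 + b ^+ 2 <= 1.
  rewrite -[leRHS](expr1n _ 2) -[leLHS]sqr_sqrtr ?addr_ge0 ?sqr_ge0//.
  by rewrite ler_sqr// ?nnegrE ?sqrtr_ge0.
move=> h; have b2 := sqr_ge0 b.
have a2 : 1 <= a ^+ 2 by rewrite expr_ge1// (le_trans _ a1).
have /eqP : b ^+ 2 = 0 by lra.
rewrite sqrf_eq0 => /eqP b0.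
have a11 : a ^+ 2 = 1 by rewrite b0 in h *; lra.
have -> : a = 1.
  by apply/eqP; rewrite -(@eqrXn2 _ 2) ?ler01 ?(le_trans _ a1)// a11 expr1n.
by rewrite b0.
Qed.

End ComplexModulus.

Section RealNorm.
Context (R : realType) (E : normedModType R[i]).
Implicit Types (x y : E) (k : R[i]) (t : R).

(** The norm of a normed space over [R[i]] is [R[i]]-valued; this is the same
    number as an element of the ordered field [R]. *)
Definition nrm x : R := Re `|x|.

Lemma nrmE x : `|x| = (nrm x)%:C.
Proof. by rewrite RRe_real// normr_real. Qed.

Lemma nrm_ge0 x : 0 <= nrm x.
Proof. by rewrite -ler0c -nrmE. Qed.

Lemma nrm0 : nrm 0 = 0.
Proof. by rewrite /nrm normr0. Qed.

Lemma nrmN x : nrm (- x) = nrm x.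
Proof. by rewrite /nrm normrN. Qed.

Lemma nrmD x y : nrm (x + y) <= nrm x + nrm y.
Proof. by rewrite -lecR rmorphD/= -!nrmE ler_normD. Qed.

Lemma nrmZ k x : nrm (k *: x) = normc k * nrm x.
Proof. by apply: complexI; rewrite rmorphM/= -!nrmE normrZ. Qed.

Lemma nrmZr t x : 0 <= t -> nrm (t%:C *: x) = t * nrm x.
Proof. by move=> t0; rewrite nrmZ normc_real. Qed.

Lemma nrm_le1 x : (`|x| <= 1) = (nrm x <= 1).
Proof. by rewrite nrmE -lecR. Qed.

End RealNorm.

(** Restriction of scalars, needed because the extension theorem is about real
    functionals. *)
Definition realified (R : realType) (V : lmodType R[i]) : Type := V.

Section Realified.
Context (R : realType) (V : lmodType R[i]).

HB.instance Definition _ := GRing.Zmodule.on (realified V).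

Let scale (t : R) (x : realified V) : realified V := t%:C *: (x : V).

Fact realified_scaleA s t x : scale s (scale t x) = scale (s * t) x.
Proof. by rewrite /scale scalerA rmorphM. Qed.

Fact realified_scale1 : left_id 1 scale.
Proof. by move=> x; rewrite /scale scale1r. Qed.

Fact realified_scaleDr : right_distributive scale +%R.
Proof. by move=> t x y; exact: scalerDr. Qed.

Fact realified_scaleDl x : {morph scale^~ x : s t / s + t}.
Proof. by move=> s t; rewrite /scale rmorphD; exact: scalerDl. Qed.

HB.instance Definition _ := GRing.Zmodule_isLmodule.Build R (realified V)
  realified_scaleA realified_scale1 realified_scaleDr realified_scaleDl.

Lemma realified_scaleE (t : R) (x : V) :
  t *: (x : realified V) = t%:C *: x :> V.
Proof. by []. Qed.

(** Complex linearity forces [g x = f x - i f (i x)]. *)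
Lemma complexify (f : realified V -> R) : scalar f ->
  exists2 g : V -> R[i]^o, linear g & forall x, Re (g x) = f x.
Proof.
move=> sf.
have fD x y : f (x + y) = f x + f y by exact: (@linear_atD _ _ R^o).
have fZ (t : R) (x : V) : f (t%:C *: x) = t * f x.
  exact: (@linear_atZ _ (realified V) R^o f sf).
have fN x : f (- x) = - f x.
  by rewrite -scaleN1r (@linear_atZ _ (realified V) R^o f sf) scaleN1r.
pose g (x : V) : R[i]^o := f x +i* (- f ('i%C *: x)).
exists g; last by [].
move=> k x y; rewrite /g.
have fk (z : V) : f (k *: z) = Re k * f z + complex.Im k * f ('i%C *: z).
  have kz : k *: z = (Re k)%:C *: z + (complex.Im k)%:C *: ('i%C *: z).
    by rewrite {1}[k]complexE scalerDl scalerA ['i%C * _]mulrC.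
  have -> : f (k *: z) = f ((Re k)%:C *: z) + f ((complex.Im k)%:C *: ('i%C *: z)).
    by rewrite -fD -kz.
  by rewrite !fZ.
have -> : f (k *: x + y) = f (k *: x) + f y by exact: fD.
have -> : f ('i%C *: (k *: x + y)) = f (k *: ('i%C *: x)) + f ('i%C *: y).
  by rewrite scalerDr fD !scalerA mulrC.
rewrite !fk scalerA.
have -> : f (('i%C * 'i%C) *: x) = - f x.
  by rewrite -expr2 sqr_i scaleN1r fN.
rewrite /GRing.scale/=; case: k {fk} => a b /=.
by apply/eqP; rewrite eq_complex/=; apply/andP; split; apply/eqP; ring.
Qed.

End Realified.

Section DualNorm.
Context (R : realType) (E : normedModType R[i]).
Implicit Types (f : E -> R[i]^o) (M : R).

Lemma sublinear_nrm : sublinear (@nrm R E : realified E -> R).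
Proof. by split=> [x y|t x t0]; [exact: nrmD|exact: nrmZr]. Qed.

Lemma linear_normc_le f M : linear f ->
  (forall x, nrm x <= 1 -> Re (f x) <= M) ->
  forall x, nrm x <= 1 -> normc (f x) <= M.
Proof.
move=> lf fM x x1; apply: normc_le_Re => u u1.
rewrite -[u * _](linear_atZ lf).
by apply: fM; rewrite nrmZ mulr_ile1 ?normc_ge0 ?nrm_ge0.
Qed.

Lemma dual_norm_le f M : (forall x, nrm x <= 1 -> normc (f x) <= M) ->
  dual_norm f <= M.
Proof.
move=> fM; apply: ge_sup.
  by exists (normc (f 0)), 0 => //=; rewrite nrm_le1 nrm0.
by move=> _ [x /= + <-]; rewrite nrm_le1; exact: fM.
Qed.

Lemma bounded_continuous f M : linear f ->
  (forall x, normc (f x) <= M * nrm x) -> continuous f.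
Proof.
move=> lf fM.
pose F := GRing.isLinear.Build _ _ _ _ f lf.
pose f' : {linear E -> R[i]^o} := HB.pack f F.
apply: (@bounded_linear_continuous _ _ _ f').
apply/linear_boundedP.
exists M%:C; split; first by rewrite complex_real.
move=> r Mr x; apply: le_trans (_ : (M * nrm x)%:C <= _).
  by rewrite lecR.
by rewrite rmorphM/= -nrmE ler_wpM2r// ltW.
Qed.

Lemma continuous_bounded f : dual E f ->
  exists2 M, 0 <= M & forall x, normc (f x) <= M * nrm x.
Proof.
move=> [lf cf].
pose F := GRing.isLinear.Build _ _ _ _ f lf.
pose f' : {linear E -> R[i]^o} := HB.pack f F.
have : bounded_near f' (nbhs (0 : E)) by apply/linear_bounded_continuous.
move=> /linear_boundedP /pinfty_ex_gt0[r r0 fr].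
have rE : r = (Re r)%:C by rewrite RRe_real// gtr0_real.
exists (Re r) => [|x]; first by rewrite -ler0c -rE ltW.
by rewrite -lecR rmorphM/= -rE -nrmE; exact: fr.
Qed.

Lemma normc_le_dual_norm f x : dual E f -> normc (f x) <= dual_norm f * nrm x.
Proof.
move=> df; have [M M0 fM] := continuous_bounded df; have [lf _] := df.
have ub : has_ubound [set normc (f x) | x in [set x : E | `|x| <= 1]].
  exists M => _ [y /= + <-]; rewrite nrm_le1 => y1.
  by apply: le_trans (fM y) _; rewrite ler_piMr.
have [x0|x0] := eqVneq (nrm x) 0.
  by rewrite (le_trans (fM _))// x0 !mulr0.
have x1 : 0 < nrm x by rewrite lt_def x0 nrm_ge0.
rewrite -ler_pdivrMr//.
have -> : normc (f x) / nrm x = normc (f ((nrm x)^-1%:C *: x)).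
  rewrite (linear_atZ lf) [normc (_ *: _)]Normc.normcM.
  by rewrite normc_real ?invr_ge0 ?nrm_ge0// mulrC.
apply: ub_le_sup => //; exists ((nrm x)^-1%:C *: x) => //=.
by rewrite nrm_le1 nrmZr ?invr_ge0 ?nrm_ge0// mulVf.
Qed.

End DualNorm.

(** * The predual pairing *)

Section Predual.
Context (R : realType) (A E : normedModType R[i]) (J : A -> E -> R[i]^o).
Hypothesis hJ : is_dual_of J.
Implicit Types (a b : A) (e : E).

Let linear_J : linear J. Proof. by case: hJ. Qed.

Lemma J_dual a : dual E (J a).
Proof. by case: hJ => _ [Jf _ _] _; exact: Jf. Qed.

Lemma J_Dl a b e : J (a + b) e = J a e + J b e.
Proof. by rewrite (linear_atD linear_J). Qed.

Lemma J_Zl k a e : J (k *: a) e = k * J a e.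
Proof. by rewrite (linear_atZ linear_J). Qed.

Lemma J_Dr a e e' : J a (e + e') = J a e + J a e'.
Proof. exact: linear_atD (J_dual a).1 e e'. Qed.

Lemma J_Zr a k e : J a (k *: e) = k * J a e.
Proof. exact: linear_atZ (J_dual a).1 k e. Qed.

Lemma J_Br a e e' : J a (e - e') = J a e - J a e'.
Proof. by rewrite -scaleN1r J_Dr J_Zr mulN1r. Qed.

Lemma nrm_J a : nrm a = dual_norm (J a).
Proof. by apply: complexI; rewrite -nrmE; case: hJ => _ _ ->. Qed.

Lemma normc_J_le a e : normc (J a e) <= nrm a * nrm e.
Proof. by rewrite nrm_J normc_le_dual_norm//; exact: J_dual. Qed.

Lemma nrm_J_le a M : (forall e, nrm e <= 1 -> Re (J a e) <= M) -> nrm a <= M.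
Proof.
move=> aM; rewrite nrm_J; apply/dual_norm_le/linear_normc_le => //.
by case: (J_dual a).
Qed.

Lemma nrm_J_approx a M : M < nrm a -> exists2 e, nrm e <= 1 & M < Re (J a e).
Proof.
move=> Ma; apply: contrapT => h.
have : nrm a <= M.
  by apply: nrm_J_le => e e1; rewrite leNgt; apply/negP => ?; apply: h; exists e.
by rewrite leNgt Ma.
Qed.

(** A real functional of norm at most one is the real part of an element of the
    unit ball of [A], because [J] maps onto the dual. *)
Lemma J_representation (f : realified E -> R) : scalar f ->
  (forall e, f e <= nrm e) ->
  exists2 a, nrm a <= 1 & forall e, Re (J a e) = f e.
Proof.
move=> sf f1; have [g lg gf] := complexify sf.
have g1 e : normc (g e) <= 1 * nrm e.
  rewrite mul1r; apply: normc_le_Re => u u1.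
  rewrite -[u * _](_ : g (u *: e) = _).
    by rewrite gf (le_trans (f1 _))// nrmZ ler_piMl ?nrm_ge0.
  exact: linear_atZ lg u e.
have dg : dual E g by split=> //; exact: bounded_continuous g1.
have [a _ ag] : exists2 a, [set: A] a & J a = g.
  by case: hJ => _ [_ _ Js] _; exact: Js.
exists a => [|e]; last by rewrite ag gf.
by apply: nrm_J_le => e e1; rewrite ag gf (le_trans (f1 e)).
Qed.

End Predual.

(** * The norm near the unit *)

Section BanachNorm.
Context (R : realType) (A : banachAlgType R[i]).
Implicit Types (a b x y : A) (s t : R).

Lemma nrmM x y : nrm (x * y) <= nrm x * nrm y.
Proof. by rewrite -lecR rmorphM/= -!nrmE; exact: banach_norm_mul. Qed.

Lemma nrm1 : nrm (1 : A) = 1.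
Proof. by rewrite /nrm [`|_|]banach_norm_one. Qed.

(** The only use of the multiplication.  With [x = 1 + s b] of norm at most one and
    [z = 1 - t b], the identity [(t + s) y = t x y + s z y] gives
    [nrm y <= nrm (z y)] for every [y]: the resolvent of [b] is contractive.  For
    [y = 1 + t b] the product [z y] is [1 - t^2 b^2], which turns the hypothesis at
    a single, uncontrolled [s] into a bound that is quadratic in [t] and depends on
    [b] only through its norm. *)
Lemma nrm_one_addZ_le b s t : 0 < s -> nrm (1 + s%:C *: b) <= 1 -> 0 <= t ->
  nrm (1 + t%:C *: b) <= 1 + t ^+ 2 * nrm b ^+ 2.
Proof.
move=> s0 s1 t0.
set x := 1 + s%:C *: b; set y := 1 + t%:C *: b; set z := 1 - t%:C *: b.
have zy : z * y = 1 - (t ^+ 2)%:C *: (b * b).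
  rewrite /z /y mulrDr mulr1 mulrBl mul1r -scalerAl -scalerAr scalerA.
  by rewrite addrA subrK -rmorphM.
have yxz : (t + s)%:C *: y = t%:C *: (x * y) + s%:C *: (z * y).
  rewrite !scalerAl -mulrDl -[in LHS](mul1r y) scalerAl; congr (_ * _).
  rewrite rmorphD /x /z !scalerDr scalerN !scalerA mulrC.
  by rewrite scalerDl addrACA [s%:C * _]mulrC subrr addr0.
have ts : 0 <= t + s by rewrite addr_ge0// ltW.
have y1 : (t + s) * nrm y <= t * nrm y + s * nrm (z * y).
  rewrite -nrmZr// yxz (le_trans (nrmD _ _))// !nrmZr ?(ltW s0)//.
  rewrite lerD2r ler_wpM2l// (le_trans (nrmM _ _))//.
  by rewrite ler_piMl ?nrm_ge0.
have yz : nrm y <= nrm (z * y) by rewrite -(ler_pM2l s0); lra.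
apply: le_trans yz _; rewrite zy (le_trans (nrmD _ _))// nrm1 lerD2l nrmN.
by rewrite nrmZr ?exprn_ge0// ler_wpM2l ?exprn_ge0// expr2 nrmM.
Qed.

End BanachNorm.

(** * From near states to normal states *)

Section CauchyGeometric.
Context (R : realType) (E : completeNormedModType R[i]).

Lemma geometric_lt (K eps : R) : 0 < eps -> exists n : nat, K / 2 ^+ n < eps.
Proof.
move=> e0; pose n := Num.bound `|K / eps|; exists n.
rewrite ltr_pdivrMr ?exprn_gt0//.
have Kn : K / eps < n%:R.
  by apply: le_lt_trans (ler_norm _) _; exact: archi_boundP.
rewrite mulrC -ltr_pdivrMr//; apply: lt_trans Kn _.
by rewrite -natrX ltr_nat ltn_expl.
Qed.

Lemma cvg_geometric (u : nat -> E) (K : R) :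
  (forall n, nrm (u n - u n.+1) <= K / 2 ^+ n.+1) ->
  exists l, forall n, nrm (u n - l) <= K / 2 ^+ n.
Proof.
move=> uS.
have K0 : 0 <= K.
  have := le_trans (nrm_ge0 _) (uS 0).
  by rewrite pmulr_lge0 ?invr_gt0 ?exprn_gt0.
have hS n : K / 2 ^+ n = K / 2 ^+ n.+1 + K / 2 ^+ n.+1.
  by rewrite exprS invfM; lra.
have uD m n : nrm (u n - u (n + m)%N) <= K / 2 ^+ n.
  elim: m n => [|m IH] n; first by rewrite addn0 subrr nrm0 divr_ge0 ?exprn_ge0.
  rewrite hS; have -> : u n - u (n + m.+1)%N =
      (u n - u n.+1) + (u n.+1 - u (n.+1 + m)%N) by rewrite addrA subrK addnS.
  by apply: le_trans (nrmD _ _) _; rewrite lerD.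
have un n m : (n <= m)%N -> nrm (u n - u m) <= K / 2 ^+ n.
  by move=> nm; rewrite -(subnKC nm).
have ucvg : cvg (u @ \oo).
  apply: cauchy_cvg; apply: cauchy_exP => eps eps0.
  have eE : eps = (Re eps)%:C by rewrite RRe_real// gtr0_real.
  have e0 : 0 < Re eps by rewrite -ltcR -eE.
  have [n ne] := geometric_lt K e0.
  exists (u n), n => // m /= nm; rewrite -ball_normE/= nrmE eE ltcR.
  exact: le_lt_trans (un _ _ nm) ne.
exists (lim (u @ \oo)) => n; apply/ler_addgt0Pr => eps eps0.
have /cvgrPdist_lt /(_ eps%:C) := ucvg.
rewrite ltcR => /(_ eps0) [N _ uN].
have := uN (maxn N n) (leq_maxl _ _); rewrite /= nrmE ltcR => lm.
have -> : u n - lim (u @ \oo) =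
    (u n - u (maxn N n)) + - (lim (u @ \oo) - u (maxn N n)).
  by rewrite opprB addrA subrK.
apply: le_trans (nrmD _ _) _; rewrite nrmN lerD ?(ltW lm)//.
exact: un (leq_maxr _ _).
Qed.

End CauchyGeometric.

Section NearStates.
Context (R : realType) (A : banachAlgType R[i]).

Section NormedPredual.
Context (E : normedModType R[i]) (J : A -> E -> R[i]^o).
Hypothesis hJ : is_dual_of J.
Implicit Types (a b : A) (e : E) (d h : R).

(** A subset of the realified space, because it is to be separated from points by
    real functionals. *)
Definition near_state d : set (realified E) :=
  [set e | nrm (e : E) <= 1 /\ 1 - d <= Re (J 1 (e : E))].

Lemma near_state_nonempty d : 0 < d -> near_state d !=set0.
Proof.
move=> d0; have [|e e1 /ltW ed] := @nrm_J_approx _ _ _ _ hJ (1 : A) (1 - d).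
  by rewrite nrm1; lra.
by exists e.
Qed.

Lemma convex_near_state d : convex (near_state d).
Proof.
move=> x y s t s0 t0 st [x1 xd] [y1 yd]; split; rewrite !realified_scaleE.
  apply: le_trans (nrmD _ _) _; rewrite !nrmZr//.
  by rewrite -st lerD// ler_piMr.
rewrite (J_Dr hJ) !(J_Zr hJ) ReD !Re_realM.
by have := ler_wpM2l s0 xd; have := ler_wpM2l t0 yd; nra.
Qed.

Lemma Re_J_le a e : nrm e <= 1 -> Re (J a e) <= nrm a.
Proof.
move=> e1; apply: le_trans (Re_le_normc _) _.
by apply: le_trans (normc_J_le hJ _ _) _; rewrite ler_piMr ?nrm_ge0.
Qed.

Lemma Re_J_ge a e : nrm e <= 1 -> - nrm a <= Re (J a e).
Proof.
move=> e1; rewrite lerNl.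
have -> : - Re (J a e) = Re (J (- a) e).
  by rewrite -[- a]scaleN1r (J_Zl hJ) mulN1r; case: (J a e).
by rewrite -nrmN Re_J_le.
Qed.

(** The value of [d] does not enter the conclusion: if [a] is at most [c] on the
    vectors that are [d]-close to being states, however small [d] is, then it is
    nearly so on those that are only [h^2]-close.  Indeed [b = a - c] satisfies
    [nrm (1 + s b) <= 1] for [s = d / 2]: on a near state [e] the real part of
    [e (1 + s b)] is at most [1] by the choice of [c], and on any other vector of
    the unit ball the loss [d] at the unit absorbs [s * nrm b].  The quadratic bound
    then gives [nrm (1 + h b) <= 1 + 4 h^2], and evaluating at [e] and dividing by
    [h] gives the result. *)
Lemma Re_J_near_state_le a d h (c : R) e : 0 < d -> d <= 1 -> 0 < h -> h <= 1 ->
    nrm a <= 1 -> -1 <= c -> c <= 1 ->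
    (forall e', near_state d e' -> Re (J a e') <= c) ->
  near_state (h ^+ 2) e -> Re (J a e) <= c + 6 * h.
Proof.
move=> d0 d1 h0 h1 a1 c0 c1 ac [e1 eh].
pose b := a - c%:C *: 1.
have Jb (t : R) f : Re (J (1 + t%:C *: b) f) =
    Re (J 1 f) + t * (Re (J a f) - c * Re (J 1 f)).
  rewrite (J_Dl hJ) (J_Zl hJ) ReD Re_realM /b (J_Dl hJ) -scaleNr (J_Zl hJ).
  by rewrite mulNr ReB Re_realM.
have J1 f : nrm f <= 1 -> Re (J 1 f) <= 1.
  by move=> f1; rewrite (le_trans (Re_J_le _ f1))// nrm1.
have b2 : nrm b <= 2.
  apply: le_trans (nrmD _ _) _; rewrite nrmN nrmZ nrm1 mulr1.
  have : normc c%:C <= 1 by rewrite /= expr0n/= addr0 sqrtr_sqr ler_norml c0.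
  lra.
have s1 : nrm (1 + (d / 2)%:C *: b) <= 1.
  apply: (nrm_J_le hJ) => f f1; rewrite Jb.
  have k1 := J1 _ f1; have [kd|kd] := leP (1 - d) (Re (J 1 f)).
    have := ac f (conj f1 kd); set x := Re (J a f); set y := Re (J 1 f) in k1 kd *.
    move=> xc.
    have : x - c * y <= 1 - y by nra.
    nra.
  have := Re_J_le a f1; have := Re_J_ge 1 f1; rewrite nrm1.
  set x := Re (J a f); set y := Re (J 1 f) in k1 kd *.
  move=> y0 xa; have : x - c * y <= 2 by nra.
  nra.
have hd : 0 < d / 2 by rewrite divr_gt0.
have := nrm_one_addZ_le hd s1 (ltW h0).
have b4 : nrm b ^+ 2 <= 4 by have := nrm_ge0 b; nra.
have := Re_J_le (1 + h%:C *: b) e1; rewrite Jb.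
set x := Re (J a e); set y := Re (J 1 e) in eh * => xh hb.
have y1 : y <= 1 by exact: J1.
have : h * (x - c * y) <= h * (5 * h) by nra.
rewrite ler_pM2l// => xy.
have : c * (y - 1) <= h ^+ 2 by nra.
nra.
Qed.

(** Were the convex set [near_state d] at distance more than [7 h] from [e], an
    element [a] of the unit ball of [A] would separate it from [e] with a gap of
    [7 h], while the preceding lemma allows a gap of at most [6 h]. *)
Lemma near_state_approx d h e : 0 < d -> d <= 1 -> 0 < h -> h <= 1 ->
  near_state (h ^+ 2) e ->
  exists2 e', near_state d e' & nrm (e - e' : E) <= 7 * h.
Proof.
move=> d0 d1 h0 h1 eh; apply: contrapT => far.
have [|f [sf f1 fe]] := @hahn_banach_separation R (realified E) _ (near_state d)
    e (7 * h) (@sublinear_nrm R E) (near_state_nonempty d0) (@convex_near_state d).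
  move=> e' e'd; rewrite leNgt; apply/negP => lt; apply: far.
  by exists e' => //; exact: ltW.
have [a a1 af] := J_representation hJ sf f1.
have ea : Re (J a e) <= 1 by apply: le_trans a1; apply: Re_J_le; case: eh.
have [e0 e0d] := near_state_nonempty d0.
have := fe _ e0d; rewrite -!af => e0h.
have a0 : -1 <= Re (J a e0).
  by have := Re_J_ge a e0d.1; lra.
have := @Re_J_near_state_le a d h (Re (J a e) - 7 * h) e d0 d1 h0 h1 a1.
have c0 : -1 <= Re (J a e) - 7 * h by lra.
have c1 : Re (J a e) - 7 * h <= 1 by lra.
move=> /(_ c0 c1) h6.
suff : Re (J a e) <= Re (J a e) - 7 * h + 6 * h by lra.
by apply: h6 => // e' /fe; rewrite -!af; lra.
Qed.

End NormedPredual.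

Section CompletePredual.
Context (E : completeNormedModType R[i]) (J : A -> E -> R[i]^o).
Hypothesis hJ : is_dual_of J.
Implicit Types (a b : A) (e : E) (d h : R).

(** Halving [h] at each step moves an [h^2]-near state by a geometric series to an
    exact normal state; this is where the completeness of [E] is used. *)
Lemma near_state_normal_state h e : 0 < h -> h <= 1 ->
  near_state J (h ^+ 2) e ->
  exists l : E, [/\ nrm l <= 1, J 1 l = 1 & nrm (e - l) <= 14 * h].
Proof.
move=> h0 h1 eh; pose H n : R := h / 2 ^+ n.
have H0 n : 0 < H n by rewrite divr_gt0 ?exprn_gt0.
have H1 n : H n <= 1.
  rewrite ler_pdivrMr ?exprn_gt0// mul1r (le_trans h1)// exprn_ege1//.
  by rewrite ler1n.
have [|next nextP] := @choice (nat * E)%type E (fun ne e' =>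
    near_state J (H ne.1 ^+ 2) ne.2 ->
    near_state J (H ne.1.+1 ^+ 2) e' /\ nrm (ne.2 - e') <= 7 * H ne.1).
  case=> n f /=.
  have [fn|nfn] := pselect (near_state J (H n ^+ 2) f); last by exists f.
  have [||e' e'n fe'] :=
    @near_state_approx _ _ hJ (H n.+1 ^+ 2) _ _ _ _ (H0 n) (H1 n) fn.
  - by rewrite exprn_gt0.
  - by rewrite exprn_ile1// ltW.
  - by exists e'.
pose u := fix u n := if n is m.+1 then next (m, u m) else e.
have u_near n : near_state J (H n ^+ 2) (u n).
  elim: n => [|n /(nextP (n, _))[]//].
  by rewrite /H expr0 divr1.
have uS n : nrm (u n - u n.+1) <= (14 * h) / 2 ^+ n.+1.
  have [_ /= /le_trans->//] := nextP (n, u n) (u_near n).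
  rewrite exprS invfM /H; lra.
have [l lP] := cvg_geometric uS.
have lP' (eps : R) : 0 < eps -> exists n, nrm (u n - l) < eps /\ H n < eps.
  move=> eps0; have [n ne] := geometric_lt (14 * h) eps0; exists n.
  split; first exact: le_lt_trans (lP n) ne.
  by apply: le_lt_trans ne; rewrite /H ler_pM2r ?invr_gt0 ?exprn_gt0//; lra.
have l1 : nrm l <= 1.
  apply/ler_addgt0Pr => eps /lP'[n [un _]].
  rewrite -[l](subrK (u n)); apply: le_trans (nrmD _ _) _.
  by rewrite -nrmN opprB; have := (u_near n).1; lra.
exists l; split=> //; last first.
  by have := lP 0; rewrite expr0 divr1.
apply: eq1_normc_Re.
  by apply: le_trans (normc_J_le hJ _ _) _; rewrite nrm1 mul1r.
apply/ler_addgt0Pr => eps eps0.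
have [|n [un Hn]] := lP' (eps / 2); first by rewrite divr_gt0.
have := Re_le_normc (J 1 (u n - l)).
have := normc_J_le hJ 1 (u n - l); rewrite nrm1 mul1r (J_Br hJ) ReB.
have [_ uH] := u_near n.
have : H n ^+ 2 <= H n by rewrite expr2 ler_piMr// ltW.
lra.
Qed.

End CompletePredual.
End NearStates.

(** * Approximation of states by normal states *)

Lemma linear_Re_sum (R : realType) (V : lmodType R[i]) (phi : V -> R[i]^o)
    (I : finType) (c : I -> R) (a : I -> V) : linear phi ->
  Re (phi (\sum_i (c i)%:C *: a i)) = \sum_i c i * Re (phi (a i)).
Proof.
move=> lphi; elim/big_rec2 : _ => [|i y x _ <-]; first by rewrite linear_at0.
by rewrite lphi ReD Re_realM.
Qed.

Lemma scalar_rowE (R : comPzRingType) n (f : 'rV[R]_n -> R) v : scalar f ->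
  f v = \sum_i f (delta_mx 0 i) * v 0 i.
Proof.
move=> sf; rewrite {1}[v]row_sum_delta; elim/big_rec2 : _ => [|i y x _ <-].
  exact: (@linear_at0 _ _ R^o).
by rewrite sf mulrC.
Qed.

Lemma closed_Re_le0 (R : realType) : closed [set z : R[i]^o | Re z <= 0].
Proof.
move=> z; rewrite /= leNgt => clz; apply/negP => z0.
have /clz [w [/= w0]] : nbhs z (ball z (Re z)%:C).
  by apply: nbhsx_ballx; rewrite ltcR.
rewrite -ball_normE/= => zw.
have : normc (z - w) < Re z by rewrite -ltcR.
by have := Re_le_normc (z - w); rewrite ReB; lra.
Qed.

(** The sets on the right form a filter that converges pointwise to [rho], and
    pointwise convergence is convergence in the product topology. *)
Lemma ptws_nbhs (R : realType) (A : topologicalType) (rho : A -> R[i]^o)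
    (B : set {ptws A -> R[i]^o}) :
    nbhs (rho : {ptws A -> R[i]^o}) B ->
  exists (s : seq A) (eps : R), 0 < eps /\
    forall g : A -> R[i]^o, (forall a, a \in s -> normc (rho a - g a) < eps) -> B g.
Proof.
pose F : set_system (A -> R[i]^o) := [set P |
    exists (s : seq A) (eps : R), 0 < eps /\
    forall g : A -> R[i]^o, (forall a, a \in s -> normc (rho a - g a) < eps) -> P g].
have FF : Filter F.
  split.
  - by exists [::], 1.
  - move=> P Q [s [eps [eps0 sP]]] [t [del [del0 tQ]]].
    exists (s ++ t), (Order.min eps del); split; first by rewrite lt_min eps0.
    move=> g gst; split.
      apply: sP => a as_; have := gst a.
      by rewrite mem_cat as_ lt_min => /(_ isT)/andP[].
    apply: tQ => a at_; have := gst a.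
    by rewrite mem_cat at_ orbT lt_min => /(_ isT)/andP[].
  - move=> P Q PQ [s [eps [eps0 sP]]].
    by exists s, eps; split=> // g /sP; exact: PQ.
suff : {ptws, F --> rho} by apply.
apply/pointwise_cvgP => a; apply/cvgrPdist_lt => eps eps0.
have eE : eps = (Re eps)%:C by rewrite RRe_real// gtr0_real.
exists [:: a], (Re eps); split; first by rewrite -ltcR -eE.
by move=> g /(_ a (mem_head _ _)) ga /=; rewrite eE -ltcR in ga *.
Qed.

Section NormalStates.
Context (R : realType) (A : banachAlgType R[i]) (E : completeNormedModType R[i]).
Context (J : A -> E -> R[i]^o).
Hypothesis hJ : is_dual_of J.
Implicit Types (a b : A) (rho : A -> R[i]^o) (eps : R).

(** The vectors of [E] that induce the normal states. *)
Definition normal_vectors : set E := [set l | nrm l <= 1 /\ J 1 l = 1].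

Lemma normal_vectors_nonempty : normal_vectors !=set0.
Proof.
have [e e1] := near_state_nonempty hJ (ltr01 : 0 < 1 :> R).
have [|l [l1 Jl _]] := @near_state_normal_state _ _ _ _ hJ 1 e ltr01 (lexx _).
  by rewrite expr1n.
by exists l.
Qed.

Lemma normal_vector_state l : normal_vectors l -> normal_states J (J^~ l).
Proof.
move=> [l1 Jl]; split; last by exists l.
have lin : linear (J^~ l) by move=> k a b; rewrite (J_Dl hJ) (J_Zl hJ).
have Jle a : normc (J a l) <= 1 * nrm a.
  by apply: le_trans (normc_J_le hJ _ _) _; rewrite mul1r ler_piMr ?nrm_ge0.
split => //; first by split => //; exact: bounded_continuous Jle.
by apply: dual_norm_le => a a1; apply: le_trans (Jle a) _; rewrite mul1r.
Qed.

Lemma state_Re_le rho a : states A rho -> Re (rho a) <= nrm a.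
Proof.
move=> [drho rho1 _]; apply: le_trans (Re_le_normc _) _.
by apply: le_trans (normc_le_dual_norm _ drho) _; rewrite ler_piMl ?nrm_ge0.
Qed.

(** For small [t], a vector of the unit ball that nearly attains the norm of
    [1 + t a], which is at least [1 + t r] with [r = Re (rho a)], is within
    [t * nrm a] of a state at the unit and has real part at least [r / 2] at [a].
    Correcting it to an exact normal state moves it by [14 h], where [h ^+ 2] is of
    the order of [t], so the real part at [a] stays positive. *)
Lemma state_Re_gt0 rho a : states A rho -> 0 < Re (rho a) ->
  exists2 l, normal_vectors l & 0 < Re (J a l).
Proof.
move=> srho; set r := Re (rho a) => r0.
have ra : r <= nrm a by exact: state_Re_le.
have [[rlin _] _ rho1] := srho.
(* [h] is chosen so that [14 * h * nrm a < r / 2], and [t] so that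
   [t * nrm a <= h ^+ 2]. *)
pose K := nrm a + 1; have K0 : 0 < K by have := nrm_ge0 a; rewrite /K; lra.
pose h := r / (28 * K).
have h0 : 0 < h by rewrite divr_gt0// mulr_gt0.
have hK : 28 * K * h = r by rewrite mulrC divfK// gt_eqF// mulr_gt0.
have h1 : h <= 1 by rewrite ler_pdivrMr ?mulr_gt0// /K; lra.
pose t := h ^+ 2 / K.
have t0 : 0 < t by rewrite divr_gt0// exprn_gt0.
have tK : t * K = h ^+ 2 by rewrite divfK// gt_eqF.
have : 1 + t * r <= nrm (1 + t%:C *: a).
  have -> : 1 + t * r = Re (rho (t%:C *: a + 1)).
    by rewrite rlin rho1 ReD Re_realM addrC.
  by rewrite addrC; exact: state_Re_le.
have tr : t * (r / 2) < t * r by rewrite ltr_pM2l//; lra.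
move=> tra.
have [|e e1] := @nrm_J_approx _ _ _ _ hJ (1 + t%:C *: a) (1 + t * (r / 2)).
  by apply: lt_le_trans tra; rewrite ltrD2l.
rewrite (J_Dl hJ) (J_Zl hJ) ReD Re_realM => et.
have e1' : Re (J 1 e) <= 1 by rewrite (le_trans (Re_J_le hJ _ e1))// nrm1.
have ea : Re (J a e) <= nrm a by exact: Re_J_le.
have tea : t * Re (J a e) <= h ^+ 2 by rewrite -tK ler_pM2l// /K; lra.
have er : r / 2 < Re (J a e) by rewrite -(ltr_pM2l t0); lra.
have [|l [l1 Jl el]] := @near_state_normal_state _ _ _ _ hJ h e h0 h1.
  by split=> //; have := mulr_gt0 t0 r0; lra.
exists l => //.
have := Re_le_normc (J a (e - l)); rewrite {1}(J_Br hJ) ReB.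
have := normc_J_le hJ a (e - l).
have : nrm a * nrm (e - l) < r / 2.
  have : nrm a * nrm (e - l) <= nrm a * (14 * h) by rewrite ler_wpM2l ?nrm_ge0.
  by move: hK; rewrite /K; lra.
lra.
Qed.

Lemma dissipativeP a :
  dissipative A a <-> forall l, normal_vectors l -> Re (J a l) <= 0.
Proof.
split=> [da l /normal_vector_state [sl _]|da _ [rho srho <-]].
  by apply: da; exists (J^~ l).
rewrite /= leNgt; apply/negP => /(state_Re_gt0 srho) [l Nl].
by rewrite ltNge da.
Qed.

(** Otherwise a real linear form on [R^n] separates the real parts of the values of
    [rho] from those of all normal states; it is evaluation at a real combination
    [b] of the [a i].  After subtraction of a multiple of the unit, [b] has positive
    real part at [rho] but at no normal state. *)
Lemma state_approx rho n (a : 'I_n -> A) eps : states A rho -> 0 < eps ->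
  exists2 l, normal_vectors l &
    forall i, `|Re (rho (a i)) - Re (J (a i) l)| < eps.
Proof.
move=> srho eps0; apply: contrapT => far.
have [[rlin _] _ rho1] := srho.
pose p (v : 'rV[R]_n) := \sum_i `|v 0 i|.
have sp : sublinear p.
  split=> [x y|t x t0]; rewrite /p.
    by rewrite -big_split/=; apply: ler_sum => i _; rewrite mxE ler_normD.
  by rewrite mulr_sumr; apply: eq_bigr => i _; rewrite mxE normrM ger0_norm.
pose val l := \row_i Re (J (a i) l).
have [|||f [sf _ fC]] := @hahn_banach_separation _ _ p
    [set val l | l in normal_vectors] (\row_i Re (rho (a i))) eps sp.
- by have [l Nl] := normal_vectors_nonempty; exists (val l), l.
- move=> _ _ s t s0 t0 st [l [l1 Jl] <-] [k [k1 Jk] <-].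
  exists (s%:C *: l + t%:C *: k).
    split.
      apply: le_trans (nrmD _ _) _; rewrite !nrmZr//.
      by rewrite -st lerD// ler_piMr.
    by rewrite (J_Dr hJ) !(J_Zr hJ) Jl Jk !mulr1 -rmorphD st.
  apply/rowP => i; rewrite !mxE (J_Dr hJ) !(J_Zr hJ) ReD.
  by rewrite !Re_realM.
- move=> _ [l Nl <-]; rewrite leNgt; apply/negP => lt; apply: far.
  exists l => // i; apply: le_lt_trans lt.
  rewrite /p (bigD1 i)//= !mxE lerDl.
  by apply: sumr_ge0.
pose M := f (\row_i Re (rho (a i))) - eps.
pose b := \sum_i (f (delta_mx 0 i))%:C *: a i.
have valb (phi : A -> R[i]^o) : linear phi -> phi 1 = 1 ->
    Re (phi ((- M)%:C *: 1 + b)) = f (\row_i Re (phi (a i))) - M.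
  move=> lphi phi1; rewrite lphi ReD Re_realM phi1 mulr1 linear_Re_sum//.
  rewrite (scalar_rowE _ sf) addrC; congr (_ - _).
  by apply: eq_bigr => i _; rewrite mxE.
have [|l Nl] := @state_Re_gt0 rho ((- M)%:C *: 1 + b) srho.
  by rewrite valb// /M; lra.
have [[[llin _] _ l1] _] := normal_vector_state Nl.
rewrite (valb (J^~ l))//.
have := fC _ (ex_intro2 _ _ l Nl erefl); rewrite /M /val; lra.
Qed.

(** The imaginary part of [rho a] is minus the real part of [rho (i a)]. *)
Lemma state_approx_normc rho (s : seq A) eps : states A rho -> 0 < eps ->
  exists2 l, normal_vectors l &
    forall a, a \in s -> normc (rho a - J a l) < eps.
Proof.
move=> srho eps0; have [[rlin _] _ _] := srho.
pose s' := s ++ [seq 'i%C *: a | a <- s].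
have [|l Nl ls] := @state_approx rho _ (tnth (in_tuple s')) (eps / 2) srho.
  by rewrite divr_gt0.
have {}ls a : a \in s' -> `|Re (rho a) - Re (J a l)| < eps / 2.
  by move=> /(tnthP (in_tuple s'))[i ->].
exists l => // a as_.
have h1 : `|Re (rho a) - Re (J a l)| < eps / 2.
  by apply: ls; rewrite mem_cat as_.
have : `|Re (rho ('i%C *: a)) - Re (J ('i%C *: a) l)| < eps / 2.
  by apply: ls; rewrite mem_cat map_f ?orbT.
have ReI (phi : A -> R[i]^o) : linear phi ->
    Re (phi ('i%C *: a)) = - complex.Im (phi a).
  move=> lphi; rewrite (linear_atZ lphi).
  by rewrite /GRing.scale/= mulrC ReiNIm.
have [[[llin _] _ _] _] := normal_vector_state Nl.
rewrite (ReI rho)// (ReI (J^~ l))// -opprD normrN => h2.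
have -> : rho a - J a l = (Re (rho a) - Re (J a l))%:C +
    'i%C * (complex.Im (rho a) - complex.Im (J a l))%:C.
  rewrite [LHS]complexE; case: (rho a) => ? ?; by case: (J a l) => ? ?.
apply: le_lt_trans (le_normcD _ _) _.
rewrite Normc.normcM.
have nr (x : R) : normc x%:C = `|x| by rewrite /= expr0n/= addr0 sqrtr_sqr.
have -> : normc ('i%C : R[i]) = 1 by rewrite /= expr0n/= add0r expr1n sqrtr1.
by rewrite !nr mul1r; lra.
Qed.

Lemma closed_dissipative : closed (dissipative A : set (weak_star J)).
Proof.
have -> : dissipative A = \bigcap_(l in normal_vectors)
    ((fun a : weak_star J => J a l) @^-1` [set z : R[i]^o | Re z <= 0]).
  by apply/seteqP; split=> a; rewrite dissipativeP.
apply: closed_bigI => l _.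
have cont : continuous (fun a : weak_star J => J a l).
  move=> a; apply: (@continuous_comp (weak_star J) {ptws E -> R[i]^o} _ J
    (fun g => g l)).
    exact: initial_continuous.
  exact: (@proj_continuous E (fun=> R[i]^o) l).
by move/continuous_closedP : cont; apply; exact: closed_Re_le0.
Qed.

Lemma states_sub_closure :
  (states A : set {ptws A -> R[i]^o}) `<=`
    closure (normal_states J : set {ptws A -> R[i]^o}).
Proof.
move=> rho srho B /ptws_nbhs[s [eps [eps0 sB]]].
have [l Nl ls] := state_approx_normc s srho eps0.
by exists (J^~ l); split; [exact: normal_vector_state|exact: sB].
Qed.

End NormalStates.

(** * Weak* closedness and density *)

Theorem theorem2p2 (R : realType) (A : banachAlgType R[i])
    (E : completeNormedModType R[i]) (J : A -> E -> R[i]^o)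
    (hJ : is_dual_of J) :
  closed (dissipative A : set (weak_star J)) /\
  (states A : set {ptws A -> R[i]^o}) `<=`
    closure (normal_states J : set {ptws A -> R[i]^o}).
Proof.
by split; [exact: closed_dissipative|exact: states_sub_closure].
Qed.
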